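(* Let $\mathcal{U}$ be the set of univoque numbers, i.e. the set of real numbers $q \ge 1$ for which there exists exactly one sequence $(c_i)_{i\ge 1}$ of integers with $0 \le c_i \le q$ for all $i \ge 1$ and $\sum_{i=1}^{\infty} c_i q^{-i} = 1$. Let $\overline{\mathcal{U}}$ be the topological closure of $\mathcal{U}$ in $\mathbb{R}$, and let $\mathcal{A}$ be the set of all algebraic univoque numbers, i.e. the set of all $q \in \mathcal{U}$ that are algebraic numbers. Then $\mathcal{A}$ is dense in $\overline{\mathcal{U}}$.
   Context: For a real number $q \ge 1$, a $q$-expansion is a sequence $(c_i)_{i \ge 1}$ of integers satisfying $0 \le c_i \le q$ for all $i \ge 1$ and $\frac{c_1}{q} + \frac{c_2}{q^2} + \frac{c_3}{q^3} + \cdots = 1$. A real number $q \ge 1$ is called univoque if it has exactly one $q$-expansion. ''Algebraic'' means algebraic over $\mathbb{Q}$. *)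

(* Defs.v *)
From HB Require Import structures.
From mathcomp Require Import all_boot all_order all_algebra.
From mathcomp Require Import all_classical all_reals all_analysis.
Import Order.TTheory GRing.Theory Num.Theory.
Import numFieldNormedType.Exports.

Set Implicit Arguments.
Unset Strict Implicit.
Unset Printing Implicit Defensive.

Local Open Scope classical_set_scope.
Local Open Scope ring_scope.

(* The digit c_i, i >= 1, is [c i.-1]: sequences are indexed from 0. *)
Definition q_expansion (R : realType) (q : R) (c : nat -> int) : Prop :=
  (forall i, (0 : R) <= (c i)%:~R <= q) /\
  [series (c i)%:~R / q ^+ i.+1]_i @ \oo --> (1 : R).

Definition univoque (R : realType) : set R :=
  [set q | 1 <= q /\ exists! c : nat -> int, q_expansion q c].

Definition algebraic_univoque (R : realType) : set R :=
  [set q | univoque q /\ algebraicOver (@ratr R) q].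

(* [set_type B] carries the topology induced by [T]; [subspace B] would not do,
   as it keeps the points outside [B] and makes them isolated. *)
Definition dense_in (T : topologicalType) (A B : set T) : Prop :=
  A `<=` B /\ dense [set x : set_type B | A (set_val x)].

(* Main.v *)
Require Import Defs.
From mathcomp Require Import all_boot all_order all_algebra.
From mathcomp Require Import all_classical all_reals all_analysis.
From mathcomp Require Import zify ring lra.
Import Order.TTheory GRing.Theory Num.Theory.
Import numFieldNormedType.Exports.

(** Let [q] be univoque, [M] the integer part of [q], and [c] the unique
    expansion of 1. Write [mirror M c] for the sequence of the [M - c i], and
    compare sequences lexicographically. Classically (Erdos, Joo, Komornik,
    Loreti), univoqueness is a matter of order: a sequence [c] of digits at
    most [M] that expands 1 in a base between [M] and [M + 1] is the only one
    to do so exactly when every proper tail [t] of [c] satisfies [mirror M c <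
    t < c].

    The proof approximates [c] by an eventually periodic sequence [d] of the
    same kind. Cut [c] after [m] digits, giving a word [w], and let [d] be [w]
    followed by infinitely many copies of the mirror image of [w] with its last
    digit increased by one. If [m] is such that no suffix of [w] is the mirror
    image of a prefix of [w], then [d] satisfies the same order condition
    ([periodized_lt], [periodized_mirror_lt]); such [m] are arbitrarily large
    ([settled_unbounded]).

    Expansions are handled through their remainders: [rest q c 1 n] is what is
    left of 1 after [n] digits, rescaled by [q ^+ n]. It obeys a linear
    recurrence, [c] expands 1 exactly when the remainders stay bounded, and the
    lexicographic order of digits reflects the numerical order of remainders.
    - Uniqueness of [c] forces all remainders of positive rank, mirrored or
      not, below 1, since otherwise a digit could be changed ([univoque_rest]);
      this gives the order condition on [c], with the weak bound [t <= c] that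
      the construction of [d] needs. Conversely the order condition on [d] puts
      its remainders below 1 ([lexlt_rest]), which gives uniqueness
      ([lex_univoque]).
    - For the eventually periodic [d], it is enough to find a base [p] in which
      two remainders one period apart are equal. Their difference is a
      polynomial in the base with rational coefficients, negative at [M] and
      positive at [M + 1]: so [p] exists, and is algebraic
      ([periodic_base_exists]).
    - Remainders separate exponentially when the base changes
      ([rest_base_mono]), so two bases in which 1 has expansions sharing a long
      prefix are close ([close_bases]). *)

Set Implicit Arguments.
Unset Strict Implicit.
Unset Printing Implicit Defensive.

Local Open Scope classical_set_scope.
Local Open Scope ring_scope.

(** * Digit sequences and their lexicographic order *)

Definition tail n (c : nat -> int) i := c (n + i)%N.
Definition mirror (M : int) (c : nat -> int) i := M - c i.
Definition digits (M : int) (c : nat -> int) := forall i, 0 <= c i <= M.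

Definition agree (a b : nat -> int) n := forall i, (i < n)%N -> a i = b i.
Definition lexle a b := forall n, agree a b n -> a n <= b n.
Definition lexlt a b := exists n, agree a b n /\ a n < b n.

(** The comparison of two sequences is settled, with answer [<], at the first
    place before [n] where they differ, or else at [n] itself. *)
Lemma lexlt_intro n a b :
  (forall i, (i < n)%N -> agree a b i -> a i <= b i) ->
  (agree a b n -> a n < b n) ->
  exists2 j, (j <= n)%N & agree a b j /\ a j < b j.
Proof.
move=> le_ab lt_ab.
have ex_i : exists i, (a i != b i) || (i == n) by exists n; rewrite eqxx orbT.
case: (ex_minnP ex_i) => j ab_j min_j.
have ab : agree a b j.
  move=> i lt_ij; apply/eqP; apply: contraLR lt_ij => ab_i.
  by rewrite -leqNgt min_j // ab_i.
have le_jn : (j <= n)%N by rewrite min_j // eqxx orbT.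
exists j => //; split=> //.
case: (ltnP j n) => [lt_jn|le_nj].
  by have := le_ab _ lt_jn ab; move: ab_j; rewrite (ltn_eqF lt_jn) orbF; lia.
have e : j = n by lia.
by rewrite e in ab *; apply: lt_ab.
Qed.

(** * Expansions and their remainders *)

(** [x] minus the sum of the first [n] terms [c i / q ^+ i.+1], times [q ^+ n]
    (see [rest_series]). The recurrence makes sense in every ring: over
    polynomials it gives the remainder as a polynomial in the base. *)
Fixpoint rest (R : pzRingType) (q : R) (c : nat -> int) (x : R) n : R :=
  if n is n'.+1 then q * rest q c x n' - (c n')%:~R else x.

Lemma rest_add (R : pzRingType) (q : R) c x m n :
  rest q c x (m + n)%N = rest q (tail m c) (rest q c x m) n.
Proof. by elim: n => [|n IH]; rewrite ?addn0 // addnS /= IH. Qed.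

Lemma eq_rest (R : pzRingType) (q : R) c d x n :
  agree c d n -> rest q c x n = rest q d x n.
Proof.
elim: n => //= n IH cd; rewrite IH ?cd // => i lt_in.
by apply: cd; apply: ltnW.
Qed.

Lemma rest_diff (R : pzRingType) (q : R) c x y n :
  rest q c x n - rest q c y n = q ^+ n * (x - y).
Proof.
elim: n => [|n IH]; first by rewrite mul1r.
by rewrite /= exprS -mulrA -IH mulrBr opprD opprK addrACA addNr addr0.
Qed.

Lemma rest_agree (R : pzRingType) (q : R) a b x y n :
  agree a b n -> rest q a x n - rest q b y n = q ^+ n * (x - y).
Proof. by move=> ab; rewrite (eq_rest q x ab) rest_diff. Qed.

(** [L] is the largest number that has an expansion with digits at most [M];
    mirroring the digits turns an expansion of [x] into one of [L - x]. *)
Lemma rest_mirror (R : comNzRingType) (q L x : R) M c n :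
  q * L = L + M%:~R ->
  rest q (mirror M c) (L - x) n = L - rest q c x n.
Proof.
move=> qL; elim: n => //= n ->; rewrite mulrBr qL /mirror intrB; ring.
Qed.

Lemma rest_le (R : realDomainType) (q : R) c x n :
  0 <= q -> (forall i, 0 <= c i) -> rest q c x n <= q ^+ n * x.
Proof.
move=> q0 c0; elim: n => [|n IH]; first by rewrite mul1r.
rewrite /= exprS -mulrA lerBlDr; apply: le_trans (ler_wpM2l q0 IH) _.
by rewrite lerDl ler0z.
Qed.

Lemma rest_series (R : realType) (q : R) c n : q != 0 ->
  [series (c i)%:~R / q ^+ i.+1]_i n = 1 - rest q c 1 n / q ^+ n.
Proof.
move=> q0; rewrite /series /=; elim: n => [|n IH].
  by rewrite big_geq //= expr0 divr1 subrr.
rewrite big_nat_recr //= IH; have qn : q ^+ n != 0 by rewrite expf_neq0.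
by rewrite exprS; field; rewrite q0 qn.
Qed.

Lemma digits_le_base (R : realType) (q : R) c M : M%:~R <= q < (M + 1)%:~R ->
  digits M c <-> (forall i, (0 : R) <= (c i)%:~R <= q).
Proof.
move=> /andP[Mq qM]; split=> c_dig i; move: (c_dig i) => /andP[c0 cM].
  by rewrite ler0z c0 /= (le_trans _ Mq) // ler_int.
rewrite ler0z in c0; rewrite c0 /= -ltzD1 -(ltr_int R).
exact: le_lt_trans qM.
Qed.

Lemma cvg_geometric_inv (R : realType) (q B : R) :
  1 < q -> (fun n => B * q^-1 ^+ n) @ \oo --> (0 : R).
Proof.
move=> q1; have q0 : 0 < q by apply: lt_trans q1.
by apply: cvg_geometric; rewrite gtr0_norm ?invr_gt0 // invf_lt1.
Qed.

Lemma geometric_bounded_le0 (R : realType) (q B x : R) :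
  1 < q -> (forall k, q ^+ k * x <= B) -> x <= 0.
Proof.
move=> q1 bnd; have q0 : 0 < q by apply: lt_trans q1.
have gB := cvg_geometric_inv B q1.
rewrite -(cvg_lim _ gB) //; apply: limr_ge; first by apply/cvg_ex; exists 0.
apply: nearW => k; rewrite exprVn ler_pdivlMr ?exprn_gt0 //.
by rewrite mulrC.
Qed.

Lemma q_expansion_bounded (R : realType) (q : R) c M B :
  1 < q -> M%:~R <= q < (M + 1)%:~R ->
  digits M c -> (forall n, `|rest q c 1 n| <= B) -> q_expansion q c.
Proof.
move=> q1 qM c_dig bnd; split; first exact/(digits_le_base c qM).
have q0 : 0 < q by apply: lt_trans q1.
have -> : [series (c i)%:~R / q ^+ i.+1]_i = fun n => 1 - rest q c 1 n / q ^+ n.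
  by apply/funext => n; rewrite rest_series ?gt_eqF.
rewrite -[X in _ --> X]subr0; apply: cvgB; first exact: cvg_cst.
apply/norm_cvg0P.
apply: (squeeze_cvgr _ (cvg_cst 0) (cvg_geometric_inv B q1)); near=> n.
rewrite normr_ge0 /= normrM normfV normrX (gtr0_norm q0) exprVn.
by rewrite ler_wpM2r // invr_ge0 exprn_ge0 // ltW.
Unshelve. all: by end_near. Qed.

(** A remainder [r < 0], or [r > L], would be followed by remainders at
    distance growing like [q ^+ k] from [[0, L]], whereas for an expansion of 1
    the remainder of rank [n], divided by [q ^+ n], tends to 0. *)
Lemma q_expansion_rest (R : realType) (q : R) c M :
  1 < q -> M%:~R <= q < (M + 1)%:~R ->
  q_expansion q c -> forall n, 0 <= rest q c 1 n <= M%:~R / (q - 1).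
Proof.
move=> q1 qM [/(digits_le_base c qM) c_dig c_cvg] n.
have q0 : 0 < q by apply: lt_trans q1.
have q10 : 0 < q - 1 by rewrite subr_gt0.
have M0 : 0 <= M by have := c_dig 0%N; lia.
set L := M%:~R / (q - 1); have L0 : 0 <= L by rewrite divr_ge0 ?ler0z // ltW.
have qL : q * L = L + M%:~R by rewrite /L; field; rewrite gt_eqF.
have {c_cvg} r_cvg : (fun n => rest q c 1 n / q ^+ n) @ \oo --> (0 : R).
  rewrite (_ : (fun n => _) =
      fun n => 1 - [series (c i)%:~R / q ^+ i.+1]_i n); last first.
    by apply/funext => k; rewrite rest_series ?gt_eqF // opprB addrC subrK.
  rewrite -[X in _ --> X](subrr 1); apply: cvgB => //; exact: cvg_cst.
have no_drift e : 0 < e ->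
    ~ forall k, e <= `|rest q c 1 (n + k)%N / q ^+ (n + k)%N|.
  move=> e0 far.
  have /cvgr0Pnorm_lt /(_ e e0) [N _ near0] := r_cvg.
  have := near0 (n + N)%N (leq_addl _ _); rewrite /= ltNge => /negP; apply.
  exact: far.
have qn := exprn_gt0 n q0.
apply/andP; split; rewrite leNgt; apply/negP => lt_r.
  apply: (no_drift (- rest q c 1 n / q ^+ n)).
    by rewrite divr_gt0 ?oppr_gt0.
  move=> k; rewrite normrM normfV normrX (gtr0_norm q0) exprD.
  have qk := exprn_gt0 k q0.
  rewrite ler_pdivlMr ?mulr_gt0 // mulrA divfK ?gt_eqF // mulNr mulrC.
  have := @rest_le _ q (tail n c) (rest q c 1 n) k (ltW q0).
  rewrite -rest_add => le_r.
  rewrite -normrN; apply: le_trans (ler_norm _); rewrite lerN2; apply: le_r.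
  by move=> i; have := c_dig (n + i)%N => /andP[].
apply: (no_drift ((rest q c 1 n - L) / q ^+ n)).
  by rewrite divr_gt0 ?subr_gt0.
move=> k; rewrite normrM normfV normrX (gtr0_norm q0) exprD.
have qk := exprn_gt0 k q0.
rewrite ler_pdivlMr ?mulr_gt0 // mulrA divfK ?gt_eqF //.
have := @rest_le _ q (mirror M (tail n c)) (L - rest q c 1 n) k (ltW q0).
rewrite rest_mirror // -rest_add => le_r; apply: le_trans (ler_norm _).
suff : L - rest q c 1 (n + k)%N <= q ^+ k * (L - rest q c 1 n) by lra.
by apply: le_r => i; rewrite /mirror /tail; have := c_dig (n + i)%N; lia.
Qed.

Lemma q_expansion_one (R : realType) k :
  q_expansion (1 : R) (fun i => (i == k)%:R).
Proof.
split=> [i|]; first by case: eqP; rewrite !lexx ?ler01.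
apply: cvg_near_cst; exists k.+1 => // n /= kn.
rewrite rest_series ?oner_eq0 // expr1n divr1.
suff -> : rest (1 : R) (fun i => (i == k)%:R) 1 n = (n <= k)%N%:R.
  by rewrite leqNgt kn subr0.
elim: n {kn} => //= n ->; rewrite mul1r.
by case: ltngtP => /=; rewrite ?subr0 ?subrr.
Qed.

(** In base 1, the digit 1 can be put at any place. *)
Lemma univoque_gt1 (R : realType) (q : R) : univoque q -> 1 < q.
Proof.
move=> [q1 [c [_ c_uniq]]]; rewrite lt_neqAle q1 andbT; apply/eqP => eq1.
rewrite -eq1 in c_uniq.
have := c_uniq _ (q_expansion_one R 0).
rewrite (c_uniq _ (q_expansion_one R 1)).
by move=> /(congr1 (fun f => f 0%N)).
Qed.

Lemma floor_base (R : realType) (q : R) :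
  (Num.floor q)%:~R <= q < (Num.floor q + 1)%:~R.
Proof. by rewrite floor_le_tmp floorD1_gt. Qed.

Section Base.
Variables (R : realType) (q : R) (M : int).
Hypotheses (q1 : 1 < q) (qM : M%:~R <= q < (M + 1)%:~R).
Local Notation L := (M%:~R / (q - 1)).

Lemma base_digit_ge1 : 1 <= M.
Proof.
have : 1%:~R < (M + 1)%:~R :> R by apply: lt_trans q1 _; case/andP: qM.
by rewrite ltr_int; lia.
Qed.

Lemma max_restE : q * L = L + M%:~R.
Proof. by field; rewrite gt_eqF // subr_gt0. Qed.

Lemma max_rest_ge1 : 1 <= L.
Proof.
rewrite ler_pdivlMr ?subr_gt0 // mul1r lerBlDr.
by case/andP: qM => _; rewrite intrD => /ltW.
Qed.

(** The greedy algorithm: the largest possible digit keeps the remainder in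
    [[0, L]], where [1 <= L] because [q <= M + 1]. *)
Lemma expansion_exists (x : R) : 0 <= x <= L ->
  exists2 e, digits M e & forall n, 0 <= rest q e x n <= L.
Proof.
move=> xL.
pose g y := Num.min (Num.floor (q * y)) M.
pose X := fix X n := if n is n'.+1 then q * X n' - (g (X n'))%:~R else x.
have XL n : 0 <= X n <= L.
  elim: n => //= n; move: (X n) => y /andP[X0 XnL].
  have qy : q * y <= L + M%:~R.
    by rewrite -max_restE ler_wpM2l // ltW // (lt_trans ltr01).
  have /andP[fl fu] := floor_base (q * y); rewrite /g /Order.min.
  move: fu; rewrite intrD; have := max_rest_ge1.
  case: (ltP (Num.floor (q * y)) M) => [_|Mf] => [L1 fu|].
    by apply/andP; split; lra.
  move=> L1 fu.
  have MF : (M%:~R : R) <= (Num.floor (q * y))%:~R by rewrite ler_int.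
  by apply/andP; split; lra.
exists (fun n => g (X n)).
  move=> n; have /andP[X0 _] := XL n; rewrite /g ge_min lexx orbT andbT le_min.
  rewrite floor_ge0 mulr_ge0 ?(ltW (lt_trans ltr01 q1)) //=.
  by have := base_digit_ge1; lia.
move=> n; suff -> : rest q (fun n => g (X n)) x n = X n by [].
by elim: n => //= n ->.
Qed.

Lemma rest_bounded_expansion c : digits M c ->
  (forall n, 0 <= rest q c 1 n <= L) -> q_expansion q c.
Proof.
move=> c_dig bnd; apply: (q_expansion_bounded q1 qM c_dig) => n.
by have /andP[r0 rL] := bnd n; rewrite ger0_norm //; exact: rL.
Qed.

Lemma q_expansion_digits c : q_expansion q c -> digits M c.
Proof. by case=> /(digits_le_base c qM). Qed.

End Base.

(** * Order conditions from uniqueness *)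

Section Univoque.
Variables (R : realType) (q : R) (M : int) (c : nat -> int).
Hypotheses (q1 : 1 < q) (qM : M%:~R <= q < (M + 1)%:~R).
Local Notation L := (M%:~R / (q - 1)).

Hypotheses (c_exp : q_expansion q c).
Hypothesis (c_uniq : forall e, q_expansion q e -> c = e).

(** A digit after which the remainder could still be expanded would start
    another expansion of 1. *)
Lemma univoque_digit n b : 0 <= b <= M ->
  0 <= q * rest q c 1 n - b%:~R <= L -> b = c n.
Proof.
move=> bM /(expansion_exists q1 qM)[e e_dig e_bnd].
have c_dig := q_expansion_digits qM c_exp.
pose f i := if (i < n)%N then c i else if i == n then b else e (i - n.+1)%N.
have fc : agree f c n by move=> i; rewrite /f => ->.
have fn : f n = b by rewrite /f ltnn eqxx.
have -> // : c = f.
apply: c_uniq; apply: (rest_bounded_expansion q1 qM).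
  move=> i; rewrite /f; case: ifP => // _; case: ifP => // _; exact: e_dig.
move=> k; case: (leqP k n) => [kn|nk].
  rewrite (@eq_rest _ _ _ c) => [|i ik]; last by rewrite fc // (leq_trans ik).
  exact: q_expansion_rest.
rewrite -(subnKC nk) rest_add /= fn (eq_rest q 1 fc).
rewrite (@eq_rest _ _ _ e) // => i _; rewrite /tail /f.
by rewrite ltnNge (_ : (n <= _)%N) /= 1?[_ == n]gtn_eqF ?addKn //; lia.
Qed.

(** If [c n < M], a remainder at least 1 after place [n] would allow the digit
    [c n + 1]; if [c n = M], the remainder is at most [q * r - M] for the
    previous remainder [r <= 1], hence below 1 because [q < M + 1]. The
    mirrored statement is similar, with [c n - 1] and the cases [0 < c n] and
    [c n = 0]; its induction can start because the first digit is [M]. *)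
Lemma univoque_rest n : (0 < n)%N -> rest q c 1 n < 1 /\ L - rest q c 1 n < 1.
Proof.
have c_dig := q_expansion_digits qM c_exp.
have r_bnd := q_expansion_rest q1 qM c_exp.
have lt1 k : c k < M -> rest q c 1 k.+1 < 1.
  move=> ckM; rewrite ltNge; apply/negP => /= ge1.
  suff : c k + 1 = c k by lia.
  apply: univoque_digit; first by have := c_dig k; lia.
  by have := r_bnd k.+1; rewrite /= intrD; lra.
have mirror_lt1 k : 0 < c k -> L - rest q c 1 k.+1 < 1.
  move=> ck0; rewrite ltNge; apply/negP => /= ge1.
  suff : c k - 1 = c k by lia.
  apply: univoque_digit; first by have := c_dig k; lia.
  by have := r_bnd k.+1; rewrite /= intrB; lra.
have qM1 : M%:~R <= q < M%:~R + 1 by move: qM; rewrite intrD.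
have MR : 1 <= (M%:~R : R) by rewrite ler1z (base_digit_ge1 q1 qM).
case: n => // n _; elim: n => [|n [IH1 IH2]].
  have r1 : rest q c 1 1 < 1.
    have [/lt1 //|Mc] := ltP (c 0%N) M.
    rewrite /= mulr1; have : (M%:~R : R) <= (c 0%N)%:~R by rewrite ler_int.
    lra.
  split=> //; apply: mirror_lt1; rewrite -(ltr0z R).
  by move: r1; rewrite /= mulr1; lra.
split.
  have [/lt1 //|Mc] := ltP (c n.+1) M.
  have : (M%:~R : R) <= (c n.+1)%:~R by rewrite ler_int.
  case/andP: qM1 => _ ltqM.
  have : q * (1 - rest q c 1 n.+1) > 0.
    by rewrite mulr_gt0 ?subr_gt0 // (lt_trans ltr01).
  by rewrite [rest q c 1 n.+2]/= mulrBr mulr1; move: (q * _) => r; lra.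
have [/mirror_lt1 //|c0] := ltP 0 (c n.+1).
have : (c n.+1)%:~R <= 0 :> R by rewrite lerz0.
have : q * (1 - (L - rest q c 1 n.+1)) > 0.
  by rewrite mulr_gt0 ?subr_gt0 // (lt_trans ltr01).
case/andP: qM1 => _ ltqM; move: (max_restE M q1).
by rewrite [rest q c 1 n.+2]/= !mulrBr mulr1; lra.
Qed.

Lemma univoque_first : c 0%N = M.
Proof.
have := q_expansion_digits qM c_exp 0%N.
have [] := univoque_rest (ltn0Sn 0) => + _; rewrite /= mulr1 => lt1.
have : (M%:~R : R) < (c 0%N + 1)%:~R.
  by rewrite intrD; case/andP: qM; lra.
by rewrite ltr_int; lia.
Qed.

Lemma univoque_rest_le1 n : rest q c 1 n <= 1.
Proof. by case: n => // n; have [/ltW] := univoque_rest (ltn0Sn n). Qed.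

(** At the first place where [a] has a larger digit than [c], the difference of
    at least 1 outweighs what follows in [c], a remainder at most 1; so [a]
    expands a number at least 1. *)
Lemma univoque_lexle a x : (forall n, 0 <= rest q a x n) -> x < 1 -> lexle a c.
Proof.
move=> r0 x1 n ac; rewrite leNgt; apply/negP => lt_ca.
have := rest_agree q x 1 ac.
have := r0 n.+1; have := univoque_rest_le1 n.+1; rewrite /=.
have : ((c n + 1)%:~R : R) <= (a n)%:~R by rewrite ler_int; lia.
have : 0 < q ^+ n by rewrite exprn_gt0 // (lt_trans ltr01).
rewrite intrD; move: (q ^+ n) (rest q a x n) (rest q c 1 n) => Q s t.
move=> Q0 ca t1 s0 st; have : q * (s - t) < 0.
  by rewrite st !pmulr_rlt0 ?subr_lt0 // (lt_trans ltr01).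
by rewrite mulrBr; lra.
Qed.

Lemma univoque_tail_le n : (0 < n)%N -> lexle (tail n c) c.
Proof.
move=> n0; have [lt1 _] := univoque_rest n0.
apply: univoque_lexle lt1 => k; rewrite -rest_add.
by case/andP: (q_expansion_rest q1 qM c_exp (n + k)).
Qed.

(** Equality would make [mirror M (tail n c)] and [c] expansions of two
    different numbers with the same digits. *)
Lemma univoque_mirror_lt n : (0 < n)%N -> lexlt (mirror M (tail n c)) c.
Proof.
move=> n0; have [_ lt1] := univoque_rest n0.
have le_c : lexle (mirror M (tail n c)) c.
  apply: univoque_lexle lt1 => k.
  rewrite rest_mirror ?(max_restE M q1) // -rest_add.
  by rewrite subr_ge0; case/andP: (q_expansion_rest q1 qM c_exp (n + k)).
apply: contrapT => nlt.
have eq_c k : agree (mirror M (tail n c)) c k.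
  elim: k => // k IH i; rewrite ltnS leq_eqVlt => /predU1P[->|]; last exact: IH.
  apply: le_anti; rewrite le_c //= leNgt; apply/negP => lt_k.
  by apply: nlt; exists k.
have no_drift k : q ^+ k * (1 - (L - rest q c 1 n)) <= 1.
  have agr : agree c (mirror M (tail n c)) k by move=> i /eq_c ->.
  rewrite -(rest_agree q _ _ agr) rest_mirror ?(max_restE M q1) // -rest_add.
  have /andP[_] := q_expansion_rest q1 qM c_exp (n + k).
  by have := univoque_rest_le1 k; lra.
by have := geometric_bounded_le0 q1 no_drift; lra.
Qed.

End Univoque.

(** * Uniqueness from order conditions *)

Section Converse.
Variables (R : realType) (q : R) (M : int) (d : nat -> int).
Hypotheses (q1 : 1 < q) (qM : M%:~R <= q < (M + 1)%:~R).
Local Notation L := (M%:~R / (q - 1)).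
Hypothesis d_exp : q_expansion q d.

(** A zero remainder is only followed by zero digits, whose mirror images [M]
    are not exceeded by any digit. *)
Lemma rest_gt0 n : lexlt (mirror M (tail n d)) d -> 0 < rest q d 1 n.
Proof.
have d_dig := q_expansion_digits qM d_exp.
have r_bnd := q_expansion_rest q1 qM d_exp.
move=> [j [_ lt_j]]; rewrite lt_neqAle eq_sym (andP (r_bnd n)).1 andbT.
apply/eqP => rn0; have r0 k : rest q d 1 (n + k)%N = 0.
  elim: k => [|k IH]; first by rewrite addn0.
  apply: le_anti; rewrite (andP (r_bnd _)).1 andbT addnS /= IH mulr0 sub0r.
  by rewrite oppr_le0 ler0z; case/andP: (d_dig (n + k)%N).
have := r0 j.+1; rewrite addnS /= r0 mulr0 sub0r => /eqP.
rewrite oppr_eq0 intr_eq0 => /eqP dj.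
by move: lt_j (d_dig j); rewrite /mirror /tail dj; lia.
Qed.

(** Parry's argument. When the comparison of [tail n a] with [d] is settled
    after [k] digits, it gives [q ^+ k * (s n - 1) <= s (n + k) - 1 - r k],
    where [s] and [r] are the remainders of [a] and [d]. So any excess of [s
    n] over 1 would grow exponentially, against the bound [L]; hence [s <= 1],
    and then the term [r k] makes the inequality strict. *)
Lemma lexlt_rest a x :
  (forall n, rest q a x n <= L) -> (forall n, lexlt (tail n a) d) ->
  (forall n, (0 < n)%N -> 0 < rest q d 1 n) -> x < 1.
Proof.
move=> bnd lt_ad r_gt0; have q0 : 0 < q by apply: lt_trans q1.
have step n : exists2 k, (0 < k)%N &
    q ^+ k * (rest q a x n - 1) <= rest q a x (n + k)%N - 1 - rest q d 1 k.
  have [j [agr lt_j]] := lt_ad n; exists j.+1 => //.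
  have := rest_agree q (rest q a x n) 1 agr; rewrite -rest_add => E.
  rewrite exprS -mulrA -E addnS /= mulrBr.
  have : ((a (n + j)%N + 1)%:~R : R) <= (d j)%:~R.
    by rewrite ler_int; move: lt_j; rewrite /tail; lia.
  by rewrite intrD; lra.
have bndK K n : q ^+ K * (rest q a x n - 1) <= L.
  have L1 := max_rest_ge1 q1 qM.
  elim: K n => [|K IH] n; first by have := bnd n; rewrite mul1r; lra.
  have [lt_0|gt_0] := lerP (rest q a x n - 1) 0.
    apply: le_trans (_ : 0 <= _); last lra.
    by rewrite pmulr_rle0 // exprn_gt0.
  have [k k0 le_k] := step n; apply: le_trans (IH (n + k)%N).
  rewrite exprSr -mulrA ler_pM2l ?exprn_gt0 //.
  apply: le_trans (_ : q ^+ k * (rest q a x n - 1) <= _).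
    rewrite ler_pM2r // -[leLHS]expr1; apply: ler_weXn2l => //; exact: ltW.
  by have := r_gt0 _ k0; lra.
have le1 n : rest q a x n <= 1.
  by rewrite -subr_le0; apply: (geometric_bounded_le0 q1 (B := L)).
have [k k0 le_k] := step 0%N; rewrite -subr_lt0.
rewrite -(pmulr_rlt0 _ (exprn_gt0 k q0)).
by have := r_gt0 _ k0; have := le1 k; move: le_k; rewrite /= add0n; lra.
Qed.

Hypotheses (d_lt : forall n, (0 < n)%N -> lexlt (tail n d) d)
  (d_mirror_lt : forall n, (0 < n)%N -> lexlt (mirror M (tail n d)) d).

Lemma lex_rest n : (0 < n)%N -> rest q d 1 n < 1 /\ L - rest q d 1 n < 1.
Proof.
move=> n0; have r_bnd := q_expansion_rest q1 qM d_exp.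
have r_gt0 k : (0 < k)%N -> 0 < rest q d 1 k.
  by move=> k0; apply/rest_gt0/d_mirror_lt.
split.
  apply: (@lexlt_rest (tail n d)) => // k.
    by rewrite -rest_add; case/andP: (r_bnd (n + k)%N).
  rewrite (_ : tail k _ = tail (n + k) d).
    by apply: d_lt; rewrite addn_gt0 n0.
  by apply/funext => i; rewrite /tail addnA.
apply: (@lexlt_rest (mirror M (tail n d))) => // k.
  rewrite rest_mirror ?max_restE // -rest_add.
  by have := r_bnd (n + k)%N => /andP[]; lra.
rewrite (_ : tail k _ = mirror M (tail (n + k) d)).
  by apply: d_mirror_lt; rewrite addn_gt0 n0.
by apply/funext => i; rewrite /tail /mirror /tail addnA.
Qed.

(** At the first place where another expansion differs, its remainder would
    differ from that of [d] by at least 1 while being in [[0, L]]; this is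
    excluded by [lex_rest]. *)
Lemma lex_univoque : univoque q.
Proof.
split; first exact: ltW.
exists d; split=> // e e_exp.
have e_bnd := q_expansion_rest q1 qM e_exp.
suff agr n : agree d e n by apply/funext => i; apply: (agr i.+1).
elim: n => // n IH i; rewrite ltnS leq_eqVlt => /predU1P[->|]; last exact: IH.
have [rn_lt1 mirror_lt1] := lex_rest (ltn0Sn n).
have eq_r := eq_rest q 1 IH.
apply: le_anti; apply/andP; split; rewrite leNgt; apply/negP => lt_n.
  have : ((e n + 1)%:~R : R) <= (d n)%:~R by rewrite ler_int; lia.
  have /andP[_] := e_bnd n.+1; move: mirror_lt1; rewrite /= eq_r intrD; lra.
have : ((d n + 1)%:~R : R) <= (e n)%:~R by rewrite ler_int; lia.
have /andP[+ _] := e_bnd n.+1; move: rn_lt1; rewrite /= eq_r intrD; lra.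
Qed.

End Converse.

(** * The eventually periodic approximation *)

(** The mirror images of the first [m] digits settle, within these [m] digits,
    the comparison of every mirrored proper tail with [c]. When mirrored tails
    are at most [c], this says that no nonempty proper suffix of [c 0 ... c
    m.-1] is the mirror image of a prefix. *)
Definition settled M c m := forall k, (0 < k < m)%N ->
  exists2 j, (k + j < m)%N &
    agree (mirror M (tail k c)) c j /\ mirror M (tail k c) j < c j.

(** If some comparison is not settled within [N] digits, take the earliest
    tail, starting at [k], for which this happens, and read on until it is
    settled: this happens at place [k + j]. Earlier tails were settled before
    [N]. A later tail lies inside a stretch which, up to its last digit, is
    the mirror image of a prefix of [c], so the mirrored later tail is itself a
    tail of that prefix, which is at most [c]; the last digit makes the
    inequality strict. *)
Lemma settled_unbounded M c N :
  (forall n, (0 < n)%N -> lexle (tail n c) c) ->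
  (forall n, (0 < n)%N -> lexlt (mirror M (tail n c)) c) ->
  exists2 m, (N <= m)%N & settled M c m.
Proof.
move=> c_le c_lt.
pose P m k := exists2 j, (k + j < m)%N &
    agree (mirror M (tail k c)) c j /\ mirror M (tail k c) j < c j.
case: (pselect (settled M c N)) => [gN|bad]; first by exists N.
have ex_k : exists k, `[< (0 < k < N)%N /\ ~ P N k >].
  apply: contrapT => no_k; apply: bad => k kN; apply: contrapT => nP.
  by apply: no_k; exists k; apply/asboolP.
case: (ex_minnP ex_k) => k /asboolP[kN nPk] min_k.
have [j [agr ltj]] := c_lt k ltac:(lia).
have N_le : (N <= k + j)%N.
  by rewrite leqNgt; apply/negP => ltN; apply: nPk; exists j.
exists (k + j).+1; first lia.
move=> k' k'm; case: (ltngtP k' k) => [lt_k'k|lt_kk'|->]; last by exists j.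
  have [j' j'N H] : P N k'.
    apply: contrapT => nPk'; suff : (k <= k')%N by lia.
    by apply: min_k; apply/asboolP; split=> //; lia.
  by exists j' => //; lia.
have [||j' le_j' H] := @lexlt_intro (k + j - k') (mirror M (tail k' c)) c.
- move=> i lt_i agr_i.
  have := agr (k' - k + i)%N ltac:(lia).
  rewrite /mirror /tail (_ : k + (k' - k + i) = k' + i)%N ?[LHS]/=; last lia.
  move=> ->; apply: (c_le (k' - k)%N); first lia.
  move=> i' lt_i'; rewrite -(agr_i i' lt_i') /mirror /tail.
  have := agr (k' - k + i')%N ltac:(lia).
  by rewrite /mirror /tail (_ : k + (k' - k + i') = k' + i')%N //; lia.
- move=> agr_i; apply: (@lt_le_trans _ _ (c j)).
    by move: ltj; rewrite /mirror /tail (_ : k' + _ = k + j)%N //; lia.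
  rewrite [X in c X](_ : j = (k' - k) + (k + j - k'))%N; last lia.
  apply: (c_le (k' - k)%N); first lia.
  move=> i' lt_i'; rewrite -(agr_i i' lt_i') /mirror /tail.
  have := agr (k' - k + i')%N ltac:(lia).
  by rewrite /mirror /tail (_ : k + (k' - k + i') = k' + i')%N //; lia.
by exists j' => //; lia.
Qed.

(** With [w] the word of the first [m] digits of [c]: [w], then forever the
    mirror image of [w] with last digit increased by one. *)
Definition periodized M (c : nat -> int) m i : int :=
  if (i < m)%N then c i else M - c (i %% m)%N + (i %% m == m.-1)%N%:R.

Section Periodized.
Variables (M : int) (c : nat -> int) (m : nat).
Hypotheses (M_gt0 : 0 < M) (c_dig : digits M c) (c0 : c 0%N = M).
Hypotheses (c_le : forall n, (0 < n)%N -> lexle (tail n c) c).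
Hypotheses (m_gt1 : (1 < m)%N) (m_settled : settled M c m).
Local Notation d := (periodized M c m).

Lemma settled_last_gt0 : 0 < c m.-1.
Proof.
have [j jm [_]] := m_settled (k := m.-1) ltac:(lia).
have -> : j = 0%N by lia.
by rewrite c0 /mirror /tail addn0; lia.
Qed.

Lemma periodized_small i : (i < m)%N -> d i = c i.
Proof. by rewrite /periodized => ->. Qed.

Lemma periodized_large a i :
  (0 < a)%N -> (i < m)%N -> d (a * m + i)%N = M - c i + (i == m.-1)%N%:R.
Proof.
move=> a_gt0 im; rewrite /periodized modnMDl modn_small //.
case: ltnP => //; nia.
Qed.

Lemma periodic_index n : (m <= n)%N ->
  exists a k, [/\ (0 < a)%N, (k < m)%N & n = (a * m + k)%N].
Proof.
move=> le_mn; exists (n %/ m)%N, (n %% m)%N.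
by split; rewrite ?ltn_mod -?divn_eq ?divn_gt0; lia.
Qed.

Lemma periodized_digits : digits M d.
Proof.
move=> i; rewrite /periodized; case: ltnP => // mi.
have := c_dig (i %% m)%N; case: eqP => [->|_] /=.
  by have := settled_last_gt0; lia.
lia.
Qed.

(** A tail of [d] begins with a suffix [s] of [w], or of its modified mirror
    image [w'], which is at most the prefix of [w] of the same length: for [w]
    by the order condition on [c], for [w'] because [m] is settled, which
    leaves room for the increase of the last digit. If they are equal, what
    follows [s] in the tail is the mirror image of a prefix of [w], while what
    follows in [d] is a suffix of [w]: the former is smaller, again because [m]
    is settled. *)
Lemma periodized_lt n : (0 < n)%N -> lexlt (tail n d) d.
Proof.
move=> n_gt0; case: (ltnP n m) => [lt_nm|le_mn].
  have [j jm [agr ltj]] := m_settled (k := (m - n)%N) ltac:(lia).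
  (* settled at the latest [j] places into the periodic part of the tail *)
  have [||i _ H] := @lexlt_intro (m - n + j) (tail n d) d; last by exists i.
  - move=> i ij agr_i; rewrite /tail; case: (ltnP i (m - n)) => [im|mi].
      rewrite !periodized_small; try lia.
      apply: c_le => // i' i'i; have := agr_i _ i'i.
      by rewrite /tail !periodized_small //; lia.
    rewrite (_ : n + i = 1 * m + (i - (m - n)))%N; last lia.
    rewrite periodized_large ?periodized_small; try lia.
    have := agr (i - (m - n))%N ltac:(lia).
    rewrite /mirror /tail (_ : m - n + _ = i)%N; last lia.
    by case: eqP; lia.
  - move=> _; rewrite /tail (_ : n + _ = 1 * m + j)%N; last lia.
    rewrite periodized_large ?periodized_small; try lia.
    by move: ltj; rewrite /mirror /tail; case: eqP; lia.
have [a [k [a_gt0 km ->]]] := periodic_index le_mn.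
case: (posnP k) => [->|k_gt0].
  (* the period starts with the digit [M - c 0 = 0], as [m > 1] *)
  exists 0%N; split=> //; rewrite /tail addn0 periodized_large //; last lia.
  by rewrite periodized_small ?c0; [case: eqP|]; lia.
have [j jm [agr ltj]] := m_settled (k := k) ltac:(lia).
have [j' j'm [agr' ltj']] := m_settled (k := (m - k)%N) ltac:(lia).
have [||i _ H] := @lexlt_intro (m - k + j') (tail (a * m + k) d) d;
  last by exists i.
- move=> i ij agr_i; rewrite /tail; case: (ltnP i (m - k)) => [im|mi].
    rewrite -addnA periodized_large ?periodized_small; try lia.
    case: (ltngtP i j) => [lt_ij|lt_ji|->].
    + by have := agr _ lt_ij; rewrite /mirror /tail; case: eqP; lia.
    + have := agr_i _ lt_ji; rewrite /tail -addnA.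
      rewrite periodized_large ?periodized_small; try lia.
      by move: ltj; rewrite /mirror /tail; case: eqP; lia.
    + by move: ltj; rewrite /mirror /tail; case: eqP; lia.
  rewrite (_ : _ + i = a.+1 * m + (i - (m - k)))%N; last lia.
  rewrite periodized_large ?periodized_small; try lia.
  have := agr' (i - (m - k))%N ltac:(lia).
  rewrite /mirror /tail (_ : m - k + _ = i)%N; last lia.
  by case: eqP; lia.
- move=> _; rewrite /tail (_ : _ + _ = a.+1 * m + j')%N; last lia.
  rewrite periodized_large ?periodized_small; try lia.
  by move: ltj'; rewrite /mirror /tail; case: eqP; lia.
Qed.

(** The mirror image of a suffix of [w] is less than the prefix of the same
    length, as [m] is settled. The mirror image of a suffix of [w'] is a
    suffix of [w] with its last digit decreased, so it is less than a prefix of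
    [w] too. *)
Lemma periodized_mirror_lt n : (0 < n)%N -> lexlt (mirror M (tail n d)) d.
Proof.
move=> n_gt0; case: (ltnP n m) => [lt_nm|le_mn].
  have [j jm [agr ltj]] := m_settled (k := n) ltac:(lia).
  exists j; rewrite /mirror /tail !periodized_small; try lia.
  split=> // i ij; rewrite !periodized_small; try lia.
  exact: agr.
have [a [k [a_gt0 km ->]]] := periodic_index le_mn.
have c_le' i : agree (tail k c) c i -> c (k + i)%N <= c i.
  by case: (posnP k) => [-> //|k_gt0]; apply: c_le.
have [||i _ H] := @lexlt_intro (m.-1 - k) (mirror M (tail (a * m + k) d)) d;
  last by exists i.
- move=> i im agr_i; rewrite /mirror /tail -addnA.
  rewrite periodized_large ?periodized_small; try lia.
  suff : c (k + i)%N <= c i by case: eqP; lia.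
  apply: c_le' => i' i'i; have := agr_i _ i'i.
  rewrite /mirror /tail -addnA periodized_large ?periodized_small; lia.
- move=> agr_i; rewrite /mirror /tail -addnA.
  rewrite periodized_large ?periodized_small; try lia.
  suff : c (k + (m.-1 - k))%N <= c (m.-1 - k)%N by case: eqP; lia.
  apply: c_le' => i' i'i; have := agr_i _ i'i.
  rewrite /mirror /tail -addnA periodized_large ?periodized_small; lia.
Qed.

End Periodized.

(** * Bases of eventually periodic expansions *)

(** The gap between the two remainders is [q - p] after one digit, and each
    further digit multiplies it at least by [q]. *)
Lemma rest_base_mono (R : realDomainType) (p q : R) c n : 0 <= p <= q ->
  (forall i, 0 <= rest p c 1 i) ->
  q ^+ n * (q - p) <= rest q c 1 n.+1 - rest p c 1 n.+1.
Proof.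
move=> /andP[p0 pq] r0.
elim: n => [|n IH]; first by rewrite /= !mulr1 mul1r; lra.
have q0 := le_trans p0 pq.
have restS (x : R) : rest x c 1 n.+2 = x * rest x c 1 n.+1 - (c n.+1)%:~R by [].
have := ler_wpM2l q0 IH; rewrite mulrA -exprS.
have := mulr_ge0 (_ : 0 <= q - p) (r0 n.+1); rewrite subr_ge0 => /(_ pq).
by rewrite !restS; move: (rest q c 1 n.+1) (rest p c 1 n.+1) => s r; lra.
Qed.

(** Both remainders of rank [n.+1] are in [[0, 1]], and the common digits let
    [rest_base_mono] apply between the smaller and the larger base. *)
Lemma close_bases (R : realDomainType) (p q : R) c d n : 0 <= p -> 0 <= q ->
  agree c d n.+1 ->
  (forall i, 0 <= rest q c 1 i <= 1) -> (forall i, 0 <= rest p d 1 i <= 1) ->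
  q ^+ n * `|p - q| <= 1.
Proof.
have main (x y : R) a b : 0 <= x -> 0 <= y -> x <= y -> agree a b n.+1 ->
    (forall i, 0 <= rest x a 1 i <= 1) -> (forall i, 0 <= rest y b 1 i <= 1) ->
    y ^+ n * (y - x) <= 1.
  move=> x0 y0 xy ab xa yb.
  have xy0 : 0 <= x <= y by rewrite x0.
  apply: le_trans (rest_base_mono n xy0 (fun i => (andP (xa i)).1)) _.
  rewrite (eq_rest y 1 ab).
  by have /andP[_] := yb n.+1; have /andP[] := xa n.+1; lra.
move=> p0 q0 cd qc pd; have [pq|qp] := lerP p q.
  apply: (main p q d c) => // i /cd //.
apply: le_trans (main q p c d q0 p0 (ltW qp) cd qc pd).
by rewrite ler_pM2r ?subr_gt0 // lerXn2r ?nnegrE // ltW.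
Qed.

Lemma horner_rest (R : realType) c n (x : R) :
  (map_poly ratr (rest 'X c 1 n)).[x] = rest x c 1 n.
Proof.
elim: n => [|n IH] /=; first by rewrite rmorph1 hornerC.
rewrite rmorphB rmorphM /= map_polyX hornerD hornerN mulrC hornerMX IH mulrC.
by rewrite rmorph_int -(rmorph_int (@polyC R)) hornerC.
Qed.

Lemma equal_rests_algebraic (R : realType) (q : R) d m n :
  (exists x : R, rest x d 1 n != rest x d 1 m) ->
  rest q d 1 n = rest q d 1 m -> algebraicOver (@ratr R) q.
Proof.
move=> [x x_neq] q_eq.
exists (rest 'X d 1 n - rest 'X d 1 m).
  apply: contra_neq x_neq => P0.
  apply/eqP; rewrite -!horner_rest -subr_eq0 -hornerN -hornerD -rmorphB P0.
  by rewrite rmorph0 horner0.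
by rewrite rootE rmorphB hornerD hornerN !horner_rest q_eq subrr.
Qed.

Lemma periodic_rest_bounded (R : realType) (q : R) d m :
  (0 < m)%N -> (forall i, d (m + m + i)%N = d (m + i)%N) ->
  rest q d 1 (m + m)%N = rest q d 1 m ->
  exists B, forall n, `|rest q d 1 n| <= B.
Proof.
move=> m_gt0 d_per q_eq; exists (\sum_(i < m + m) `|rest q d 1 i|) => n.
elim/ltn_ind: n => n IH; case: (ltnP n (m + m)) => [lt_n|le_n].
  rewrite (bigD1 (Ordinal lt_n)) //= lerDl; exact: sumr_ge0.
rewrite -(subnKC le_n) rest_add q_eq (_ : tail (m + m) d = tail m d).
  by rewrite -rest_add; apply: IH; lia.
by apply/funext => i; rewrite /tail d_per.
Qed.

Section Periodic.
Variables (R : realType) (M : int) (d : nat -> int) (m : nat).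
Hypotheses (M_gt0 : 0 < M) (d_dig : digits M d) (d0 : d 0%N = M).
Hypotheses (m_gt0 : (0 < m)%N) (dm : d m < M) (dl : 0 < d (m + m).-1).

(** Since [(M + 1) * r - d n >= r + (M - d n)] for [r >= 1]. *)
Lemma rest_incr n : let q := (M + 1)%:~R : R in
  1 <= rest q d 1 n /\ rest q d 1 n + (M - d n)%:~R <= rest q d 1 n.+1.
Proof.
move=> q; have dM i : 0 <= (M - d i)%:~R :> R.
  by rewrite ler0z; have := d_dig i; lia.
have M0 : 0 <= M%:~R :> R by rewrite ler0z ltW.
have stp r i : 1 <= r -> r + (M - d i)%:~R <= q * r - (d i)%:~R.
  move=> r1; rewrite /q intrB intrD mulrDl mul1r.
  have : M%:~R * 1 <= M%:~R * r by rewrite ler_wpM2l.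
  lra.
have r1 : 1 <= rest q d 1 n.
  by elim: n => //= n IH; have := stp _ n IH; have := dM n; lra.
by split=> //; apply: stp.
Qed.

(** In base [M] the first digit already uses up 1. *)
Lemma rest_decr n : let q := M%:~R : R in
  rest q d 1 n.+1 <= 0 /\ rest q d 1 n.+2 <= rest q d 1 n.+1 - (d n.+1)%:~R.
Proof.
move=> q; have q1 : 1 <= q by rewrite ler1z; lia.
have dM i : 0 <= (d i)%:~R :> R by rewrite ler0z; have := d_dig i; lia.
have stp r i : r <= 0 -> q * r - (d i)%:~R <= r - (d i)%:~R.
  by move=> r0; rewrite lerD2r; nra.
have r0 : rest q d 1 n.+1 <= 0.
  elim: n => [|n IH]; first by rewrite /= d0 mulr1 subrr.
  by have := stp _ n.+1 IH; have := dM n.+1; rewrite -/(rest _ _ _ n.+2); lra.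
by split=> //; apply: stp.
Qed.

(** The remainders of positive rank decrease in base [M] and increase in base
    [M + 1]; strictly somewhere between ranks [m] and [m + m], because of a
    digit that is not 0 and one that is not [M]. So their difference over this
    period changes sign, and cannot be the zero polynomial. *)
Lemma periodic_base_exists : exists q : R,
  [/\ M%:~R < q, q < (M + 1)%:~R, rest q d 1 (m + m)%N = rest q d 1 m
    & algebraicOver (@ratr R) q].
Proof.
pose P : {poly R} := map_poly ratr (rest 'X d 1 (m + m)%N - rest 'X d 1 m).
have PE x : P.[x] = rest x d 1 (m + m)%N - rest x d 1 m.
  by rewrite /P rmorphB hornerD hornerN !horner_rest.
have mono_hi k :
    rest ((M + 1)%:~R : R) d 1 m.+1 <= rest (M + 1)%:~R d 1 (m.+1 + k)%N.
  elim: k => [|k IH]; first by rewrite addn0.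
  have [_] := rest_incr (m.+1 + k); rewrite addnS.
  have : 0 <= (M - d (m.+1 + k)%N)%:~R :> R.
    by rewrite ler0z; have := d_dig (m.+1 + k)%N; lia.
  by move: IH; lra.
have mono_lo k : rest (M%:~R : R) d 1 (m + k)%N <= rest M%:~R d 1 m.
  elim: k => [|k IH]; first by rewrite addn0.
  have [_] := rest_decr (m + k).-1.
  have : 0 <= (d (m + k)%N)%:~R :> R.
    by rewrite ler0z; have := d_dig (m + k)%N; lia.
  by rewrite addnS (_ : (m + k).-1.+1 = m + k)%N; [move: IH; lra | lia].
have P_lo : P.[M%:~R] < 0.
  rewrite PE subr_lt0; apply: lt_le_trans (mono_lo m.-1).
  have [_] := rest_decr (m + m).-2.
  rewrite (_ : (m + m).-2.+2 = m + m)%N; last lia.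
  rewrite (_ : (m + m).-2.+1 = m + m.-1)%N; last lia.
  have : 0 < (d (m + m.-1)%N)%:~R :> R.
    by rewrite ltr0z; move: dl; rewrite (_ : (m + m).-1 = m + m.-1)%N; lia.
  lra.
have P_hi : 0 < P.[(M + 1)%:~R].
  rewrite PE subr_gt0 (_ : m + m = m.+1 + m.-1)%N; last lia.
  apply: lt_le_trans (mono_hi m.-1).
  have [_] := rest_incr m.
  have : 0 < (M - d m)%:~R :> R by rewrite ltr0z subr_gt0.
  lra.
have [||q /andP[Mq qM] /rootP qP] := @poly_ivt R P M%:~R (M + 1)%:~R.
- by rewrite ler_int; lia.
- by rewrite !ltW.
have q_eq : rest q d 1 (m + m)%N = rest q d 1 m.
  by apply/eqP; rewrite -subr_eq0 -PE qP.
exists q; split=> //.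
- by rewrite lt_neqAle Mq andbT; apply: contraTneq P_lo => ->; rewrite qP ltxx.
- by rewrite lt_neqAle qM andbT; apply: contraTneq P_hi => <-; rewrite qP ltxx.
apply: equal_rests_algebraic q_eq; exists M%:~R.
by rewrite -subr_eq0 -PE lt_eqF.
Qed.

End Periodic.

(** * Density of algebraic univoque numbers *)

(** Agreement of [c] and [d] on [N.+1] digits bounds the distance of the bases
    by [q ^- N], whence the choice of [N]. *)
Lemma algebraic_univoque_near (R : realType) (q e : R) : univoque q -> 0 < e ->
  exists2 p, algebraic_univoque p & `|p - q| < e.
Proof.
move=> uq e0; have q1 := univoque_gt1 uq; case: uq => _ [c [c_exp c_uniq]].
pose M := Num.floor q; have qM : M%:~R <= q < (M + 1)%:~R := floor_base q.
have M1 : 1 <= M := base_digit_ge1 q1 qM.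
have c_dig := q_expansion_digits qM c_exp.
have c0 : c 0%N = M := univoque_first q1 qM c_exp c_uniq.
have c_le := univoque_tail_le q1 qM c_exp c_uniq.
have [N qN] : exists N, 1 < q ^+ N * e.
  apply: contrapT => noN.
  suff : e <= 0 by rewrite leNgt e0.
  apply: (geometric_bounded_le0 q1 (B := 1)) => k.
  by rewrite leNgt; apply/negP => ?; apply: noN; exists k.
have c_mirror_lt := univoque_mirror_lt q1 qM c_exp c_uniq.
have [m Nm m_settled] := settled_unbounded N.+2 c_le c_mirror_lt.
pose d := periodized M c m.
have M0 : 0 < M by lia.
have m1 : (1 < m)%N by lia.
have d_dig : digits M d by apply: periodized_digits.
have d_lt n : (0 < n)%N -> lexlt (tail n d) d by apply: periodized_lt.
have d_mirror_lt n : (0 < n)%N -> lexlt (mirror M (tail n d)) d.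
  exact: periodized_mirror_lt.
have dc : agree c d m by move=> i im; rewrite /d periodized_small.
have d_per i : d (m + m + i)%N = d (m + i)%N.
  rewrite /d /periodized -!addnA !modnDl.
  by rewrite !ltnNge !leq_addr.
have [||||||p [Mp pM r_per p_alg]] := @periodic_base_exists R M d m => //.
- by rewrite -dc //; lia.
- lia.
- rewrite /d -[X in _ M c m X](_ : 1 * m + 0 = m)%N; last lia.
  rewrite periodized_large //; last lia.
  rewrite c0; case: eqP; lia.
- rewrite /d (_ : (m + m).-1 = 1 * m + m.-1)%N; last lia.
  rewrite periodized_large ?eqxx //; last lia.
  by have := c_dig m.-1; lia.
have p1 : 1 < p by apply: le_lt_trans Mp; rewrite ler1z.
have pM' : M%:~R <= p < (M + 1)%:~R by rewrite ltW.
have [B r_bnd] := periodic_rest_bounded (ltnW m1) d_per r_per.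
have d_exp := q_expansion_bounded p1 pM' d_dig r_bnd.
exists p; first by split=> //; apply: lex_univoque d_lt d_mirror_lt.
have rp i : 0 <= rest p d 1 i <= 1.
  have /andP[-> _] /= := q_expansion_rest p1 pM' d_exp i.
  case: i => // i.
  by have [/ltW] := lex_rest p1 pM' d_exp d_lt d_mirror_lt (ltn0Sn i).
have rq i : 0 <= rest q c 1 i <= 1.
  have /andP[-> _] /= := q_expansion_rest q1 qM c_exp i.
  exact: univoque_rest_le1 q1 qM c_exp c_uniq i.
have agr : agree c d N.+1 by move=> i iN; apply: dc; lia.
have q0 : 0 < q by apply: lt_trans q1.
have p0 : 0 < p by apply: lt_trans p1.
have := close_bases (ltW p0) (ltW q0) agr rq rp.
rewrite ltNge => le1; apply/negP => le_e.
have := ler_wpM2l (exprn_ge0 N (ltW q0)) le_e.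
by lra.
Qed.

Theorem theorem1p1 (R : realType) :
  dense_in (@algebraic_univoque R) (closure (@univoque R)).
Proof.
split=> [q [uq _]|]; first exact: subset_closure.
move=> O [x Ox] [B openB BO].
have Bx : B (set_val x) by move: Ox; rewrite -BO.
have [q [uq Bq]] := set_valP x B (open_nbhs_nbhs (conj openB Bx)).
have /nbhs_ballP[e /= e0 ballB] := open_nbhs_nbhs (conj openB Bq).
have [p Ap pq] := algebraic_univoque_near uq e0.
have Up : closure (@univoque R) p by apply: subset_closure; case: Ap.
exists (SigSub (mem_set Up)); split=> //; rewrite -BO /=.
by apply: ballB; rewrite /ball /= distrC.
Qed.
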